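(* Let $\mathbf{X}=(X_1,\dots,X_d)$ be a random vector with Multivariate Extreme Value (MEV) distribution and unit Fréchet margins. Then for each partition $\mathcal{I}=\{I_1,\dots,I_p\}$ of $D=\{1,\dots,d\}$ and each $\lambda=(\lambda_1,\dots,\lambda_p)\in(0,\infty)^p$, $$R(\mathbf{X},\lambda,\mathcal{I})=e\left(I_j,\ j\in\{1,\dots,p\}\right)-\sum_{\emptyset\neq T\subseteq\{1,\dots,p\}}(-1)^{|T|+1}\,e\left(I_j,\ j\in T\right),$$ and, for $\lambda=\mathbf{1}=(1,\dots,1)$, $$R(\mathbf{X},\mathbf{1},\mathcal{I})=\frac{\epsilon_{\mathbf{X}}}{1+\epsilon_{\mathbf{X}}}-\sum_{\emptyset\neq T\subseteq\{1,\dots,p\}}(-1)^{|T|+1}\,\frac{\epsilon_{\mathbf{X}_{\cup_{j\in T}I_j}}}{1+\epsilon_{\mathbf{X}_{\cup_{j\in T}I_j}}}.$$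
   Context: Unit Fréchet margins: each $X_i$ has distribution function $F(x)=\exp(-x^{-1})$, $x>0$. A Multivariate Extreme Value (MEV) distribution is a max-stable distribution function with non-degenerate margins; for an MEV distribution $G$ with unit Fréchet margins this means $G(tx_1,\dots,tx_d)^t=G(x_1,\dots,x_d)$ for all $t>0$ and all $x_1,\dots,x_d>0$. Tail dependence function: for $\mathbf{X}$ with distribution $G$, $l(x_1,\dots,x_d)=-\log G(x_1^{-1},\dots,x_d^{-1})$ for $(x_1,\dots,x_d)\in[0,\infty)^d$, with the convention $0^{-1}=+\infty$ (a coordinate equal to $+\infty$ in $G$ means that the corresponding variable is left unconstrained). For $S\subseteq D$, $\delta_i(S)=1$ if $i\in S$ and $\delta_i(S)=0$ if $i\notin S$. For nonempty $S\subseteq D$, $\mathbf{X}_S$ denotes the subvector of $\mathbf{X}$ with indices in $S$, and its extremal coefficient is $\epsilon_{\mathbf{X}_S}=l(\delta_1(S),\dots,\delta_d(S))$; in particular $\epsilon_{\mathbf{X}}=l(1,\dots,1)$. A partition $\mathcal{I}=\{I_1,\dots,I_p\}$ of $D$ consists of nonempty, pairwise disjoint sets with union $D$. Put $M(I_j)=\max_{i\in I_j}X_i$. The max-min dependence coefficient is $$R(\mathbf{X},\lambda,\mathcal{I})=E\left(\max_{1\le j\le p}F^{\lambda_j}(M(I_j))-\min_{1\le j\le p}F^{\lambda_j}(M(I_j))\right),$$ where $F^{\lambda}(x)=(F(x))^{\lambda}$. For $\emptyset\neq T\subseteq\{1,\dots,p\}$, $$e(I_j,\ j\in T)=\frac{l\left(\sum_{j\in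 T}\lambda_j^{-1}\delta_1(I_j),\dots,\sum_{j\in T}\lambda_j^{-1}\delta_d(I_j)\right)}{1+l\left(\sum_{j\in T}\lambda_j^{-1}\delta_1(I_j),\dots,\sum_{j\in T}\lambda_j^{-1}\delta_d(I_j)\right)}.$$ *)

(* Defs.v *)
From HB Require Import structures.
From mathcomp Require Import all_boot all_order all_algebra.
From mathcomp Require Import all_classical all_reals all_analysis.
Set Implicit Arguments.
Unset Strict Implicit.
Unset Printing Implicit Defensive.
Import Order.TTheory GRing.Theory Num.Theory.
Import numFieldNormedType.Exports.
Local Open Scope classical_set_scope.
Local Open Scope ring_scope.

Definition frechet_cdf (R : realType) (x : R) : R :=
  if 0 < x then expR (- x^-1) else 0.

(* A coordinate +oo of [x] leaves the corresponding variable unconstrained. *)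
Definition joint_cdf (disp : measure_display) (Omega : measurableType disp)
    (R : realType) (P : probability Omega R) (d : nat)
    (X : 'I_d -> {RV P >-> R}) (x : 'I_d -> \bar R) : R :=
  fine (P [set w | forall i, ((X i w)%:E <= x i)%E]).

Definition unit_frechet_margins (disp : measure_display)
    (Omega : measurableType disp) (R : realType) (P : probability Omega R)
    (d : nat) (X : 'I_d -> {RV P >-> R}) : Prop :=
  forall i (x : R), cdf (X i) x = (frechet_cdf x)%:E.

(* Max-stability in the form it takes for unit Frechet margins, where the
   normalising constants are a_t = t and b_t = 0. *)
Definition frechet_max_stable (disp : measure_display)
    (Omega : measurableType disp) (R : realType) (P : probability Omega R)
    (d : nat) (X : 'I_d -> {RV P >-> R}) : Prop :=
  forall (t : R) (x : 'I_d -> R), 0 < t -> (forall i, 0 < x i) ->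
    joint_cdf X (fun i => (t * x i)%:E) `^ t = joint_cdf X (fun i => (x i)%:E).

(* Unit Frechet margins are non-degenerate, so that requirement of an MEV
   distribution needs no separate clause. *)
Definition unit_frechet_MEV (disp : measure_display)
    (Omega : measurableType disp) (R : realType) (P : probability Omega R)
    (d : nat) (X : 'I_d -> {RV P >-> R}) : Prop :=
  unit_frechet_margins X /\ frechet_max_stable X.

(* The inverse is that of \bar R, for which 0^-1 = +oo. *)
Definition tail_dep (disp : measure_display)
    (Omega : measurableType disp) (R : realType) (P : probability Omega R)
    (d : nat) (X : 'I_d -> {RV P >-> R}) (x : 'I_d -> R) : R :=
  - ln (joint_cdf X (fun i => (((x i)%:E)^-1)%E)).

Definition delta (R : realType) (d : nat) (i : 'I_d) (S : {set 'I_d}) : R :=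
  (i \in S)%:R.

Definition extremal_coef (disp : measure_display)
    (Omega : measurableType disp) (R : realType) (P : probability Omega R)
    (d : nat) (X : 'I_d -> {RV P >-> R}) (S : {set 'I_d}) : R :=
  tail_dep X (fun i => delta R i S).

Definition is_indexed_partition (d p : nat) (I : 'I_p -> {set 'I_d}) : Prop :=
  [/\ forall j, I j != finset.set0,
      forall j k, j != k -> I j :&: I k = finset.set0 &
      \bigcup_(j < p) I j = finset.setT]%SET.

(* M(A) for nonempty A: over a nonempty finite set the supremum is the
   maximum, so no default value enters. *)
Definition block_max (disp : measure_display)
    (Omega : measurableType disp) (R : realType) (P : probability Omega R)
    (d : nat) (X : 'I_d -> {RV P >-> R}) (A : {set 'I_d}) (w : Omega) : R :=
  sup [set X i w | i in [set` A]].

Definition max_min_coef (disp : measure_display)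
    (Omega : measurableType disp) (R : realType) (P : probability Omega R)
    (d : nat) (X : 'I_d -> {RV P >-> R}) (p : nat) (lambda : 'I_p -> R)
    (I : 'I_p -> {set 'I_d}) : \bar R :=
  let V w j := frechet_cdf (block_max X (I j) w) `^ lambda j in
  ('E_P[fun w => (sup (range (V w)) - inf (range (V w)))%R])%E.

Definition e_coef (disp : measure_display)
    (Omega : measurableType disp) (R : realType) (P : probability Omega R)
    (d : nat) (X : 'I_d -> {RV P >-> R}) (p : nat) (lambda : 'I_p -> R)
    (I : 'I_p -> {set 'I_d}) (T : {set 'I_p}) : R :=
  let a i := \sum_(j in T) (lambda j)^-1 * delta R i (I j) in
  tail_dep X a / (1 + tail_dep X a).

(* Main.v *)
Require Import Defs.
From HB Require Import structures.
From mathcomp Require Import all_boot all_order all_algebra.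
From mathcomp Require Import all_classical all_reals all_analysis.
From mathcomp Require Import measurable_realfun ring.
Set Implicit Arguments.
Unset Strict Implicit.
Unset Printing Implicit Defensive.
Import Order.TTheory GRing.Theory Num.Theory.
Import numFieldNormedType.Exports.
Local Open Scope ring_scope.

(* Write V_j = F^(lambda_j)(M(I_j)), Y_T = max_(j in T) V_j and
   a_i = \sum_(j in T) lambda_j^-1 delta_i(I_j).  For 0 < u < 1 the event
   Y_T <= u says that X_i <= (- ln u)^-1 a_i^-1 for all i, where a_i^-1 = +oo
   when i lies in no block of T; by max-stability its probability is
   u^l with l = l(a) > 0.  Integrating 1 - u^l over [0, 1] gives
   E Y_T = l / (1 + l) = e(I_j, j in T), and the maximum-minimums identity
   min_j V_j = \sum_(T != set0) (-1)^(|T|+1) Y_T concludes by linearity. *)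

(* The terms of T and j0 |: T cancel for every nonempty T avoiding j0. *)
Lemma sum_sign_bigmax (R : realDomainType) (I : finType) (v : I -> R) (j0 : I) :
    (forall j, 0 <= v j) -> (forall j, v j0 <= v j) ->
  \sum_(T : {set I} | T != finset.set0)
    (-1) ^+ (#|T| + 1) * \big[Num.max/0]_(j in T) v j = v j0.
Proof.
move=> v_ge0 v_min; pose f (T : {set I}) : R :=
  (-1) ^+ (#|T| + 1) * \big[Num.max/0]_(j in T) v j.
have f0 : f finset.set0 = 0 by rewrite /f big_pred0 ?mulr0 // => j; rewrite inE.
transitivity (\sum_(T : {set I}) f T).
  by rewrite [RHS](bigD1 finset.set0) //= f0 add0r.
rewrite (bigID (fun T : {set I} => j0 \in T)) /=.
rewrite (reindex_onto (fun T => (j0 |: T)%SET)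
  (fun T => (T :\ j0)%SET)) /=; last first.
  by move=> T Tj0; rewrite finset.setD1K.
rewrite (eq_bigl (fun T : {set I} => j0 \notin T)); last first.
  move=> T; rewrite setU11 /=; apply/eqP/idP => [<-|Tj0].
    by rewrite setD11.
  by rewrite setU1K.
(* The pair formed by [set0] and the singleton of [j0] is the only one that does not cancel; it
   contributes [v j0]. *)
rewrite -big_split /= (bigD1 finset.set0) ?inE //= big1 => [|T /andP[Tj0 T0]].
  rewrite f0 !addr0 finset.setU0 /f cards1 -signr_odd mul1r bigmax_set1.
  exact/max_idPl.
rewrite /f cardsU1 Tj0 bigmaxU bigmax_set1.
have [i iT] := set0Pn _ T0.
(* As [v j0] is minimal and [T] is nonempty, adding [j0] leaves the maximum unchanged and only flips
   the sign. *)
rewrite (max_idPl (v_ge0 j0)) (max_idPr _).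
  by rewrite !addnE /= !exprS; ring.
exact: le_trans (v_min i) (le_bigmax_cond _ _ iT).
Qed.

(** * Attained extrema, measurability of finite maxima, continuity *)

Lemma sup_eq_max (R : realType) (E : set R) (x : R) :
  E x -> ubound E x -> sup E = x.
Proof.
move=> Ex ubx; apply/le_anti/andP; split.
  by apply: ge_sup => //; exists x.
by apply: ub_le_sup => //; exists x.
Qed.

Lemma inf_eq_min (R : realType) (E : set R) (x : R) :
  E x -> lbound E x -> inf E = x.
Proof.
move=> Ex lbx; apply/le_anti/andP; split.
  by apply: ge_inf => //; exists x.
by apply: lb_le_inf => //; exists x.
Qed.

Lemma measurable_bigmaxr (disp : measure_display) (T : measurableType disp)
    (R : realType) (I : Type) (s : seq I) (Q : pred I) (f : I -> T -> R) :
    (forall i, measurable_fun setT (f i)) ->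
  measurable_fun setT (fun w => \big[Num.max/0]_(i <- s | Q i) f i w).
Proof.
move=> mf; elim: s => [|i s IHs].
  by under eq_fun do rewrite big_nil; exact: measurable_cst.
under eq_fun do rewrite big_cons.
by case: (Q i) => //; exact: measurable_maxr.
Qed.

Lemma derivable_cvg1 (R : realType) (f : R -> R) (x : R) :
  derivable f x 1 -> (f y @[y --> x] --> f x)%classic.
Proof. by move=> /derivable1_diffP /differentiable_continuous. Qed.

(** * Mean of a variable on [0, 1] with distribution function u^l *)

Lemma integral_one_sub_powR (R : realType) (l : R) : 0 < l ->
  (\int[@lebesgue_measure R]_(x in `[0%R, 1%R]) (1 - x `^ l)%:E
   = (l / (1 + l))%:E)%E.
Proof.
move=> l0; have l1 : 0 < l + 1 by rewrite addr_gt0.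
(* [F] is an antiderivative of 1 - x^l. The derivative of a power is used at positive points only,
   so continuity at 0 comes from [powR_cvg0]. *)
pose F x : R := x - (l + 1)^-1 * x `^ (l + 1).
have cpow (a : R) : 0 < a ->
      {within `[0, 1], continuous (fun x : R => x `^ a)}%classic.
  move=> a0; apply/continuous_within_itvP => //; split.
  - move=> x; rewrite in_itv /= => /andP[x0 _].
    exact: derivable_cvg1 (@ex_derive _ _ _ _ _ _ _ (is_derive1_powR a _)).
  - by rewrite powR0 ?gt_eqF //; exact: powR_cvg0.
  - apply: cvg_at_left_filter.
    exact: derivable_cvg1 (@ex_derive _ _ _ _ _ _ _ (is_derive1_powR a _)).
have dF (x : R) : 0 < x -> is_derive x 1 F (1 - x `^ l).
  move=> x0; have h := is_derive1_powR (l + 1) x0.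
  apply: is_derive_eq.
  by rewrite addrK /GRing.scale /= mulrA mulVf ?mul1r // gt_eqF.
rewrite (@continuous_FTC2 _ _ F) //.
- rewrite /F powR1 powR0 ?gt_eqF // mulr0 subr0 mulr1 sube0.
  by congr EFin; field; rewrite gt_eqF // addrC.
- move=> x; apply: cvgB; first exact: cvg_cst.
  exact: cpow.
- split.
  + by move=> x; rewrite in_itv /= => /andP[x0 _]; have [] := dF x x0.
  + rewrite /F; apply: cvgB; first exact: cvg_at_right_filter.
    apply: cvgMl_tmp. rewrite powR0 ?gt_eqF //; exact: powR_cvg0.
  + apply: cvg_at_left_filter.
    exact: derivable_cvg1 (@ex_derive _ _ _ _ _ _ _ (dF _ _)).
- move=> x; rewrite in_itv /= => /andP[x0 _].
  by rewrite derive1E; have [_ ->] := dF x x0.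
Qed.

Lemma expectation_powR_cdf (disp : measure_display)
    (Omega : measurableType disp) (R : realType) (P : probability Omega R)
    (Y : {RV P >-> R}) (l : R) : 0 < l ->
    (forall w, 0 <= Y w <= 1) ->
    (forall u, 0 < u < 1 -> cdf Y u = (u `^ l)%:E) ->
  ('E_P[Y] = (l / (1 + l))%:E)%E.
Proof.
move=> l0 Y01 Ycdf.
have cdf1 (u : R) : 1 <= u -> cdf Y u = 1%:E.
  move=> u1; rewrite /cdf /distribution /pushforward.
  rewrite -(@probability_setT _ _ _ P).
  congr (P _); apply/seteqP; split=> w //= _.
  by rewrite in_itv /=; have /andP[_ /le_trans->] := Y01 w.
(* Layer-cake formula: the mean of a nonnegative variable is the integral of its survival function.
   The endpoint 0, where the cdf of [Y] is not prescribed, is then removed; beyond 1 the integrand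
   vanishes because [Y] is at most 1. *)
rewrite ge0_expectation_ccdf; last by move=> w; have /andP[] := Y01 w.
rewrite -integral_itv_obnd_cbnd; last first.
  exact: measurable_funTS (ccdf_measurable Y).
pose g (x : R) := (1 - x `^ l)%:E.
transitivity (\int[@lebesgue_measure R]_(x in `]0%R, +oo[)
  (g \_ `]0%R, 1%R]) x)%E.
  apply: eq_integral => x; rewrite inE /= in_itv /= andbT => x0.
  rewrite ccdf_1_cdf patchE; case: ifPn => [|].
    rewrite inE /= in_itv /= x0 /= le_eqVlt => /predU1P[->|x1].
      by rewrite cdf1 // /g powR1.
    by rewrite Ycdf ?x0.
  rewrite notin_setE /= in_itv /= x0 /= => /negP; rewrite -ltNge => x1.
  by rewrite cdf1 ?ltW // subee.
rewrite -integral_mkcondr.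
rewrite (_ : (_ `&` _)%classic = `]0, 1]%classic); last first.
  apply/seteqP; split=> x; rewrite /= !in_itv /= ?andbT; first by case.
  by move=> /andP[-> ->].
rewrite integral_itv_obnd_cbnd; first exact: integral_one_sub_powR.
apply: measurable_funTS; apply/measurable_EFinP.
by apply: measurable_funB => //; exact: measurable_powR.
Qed.

(** * The unit Fréchet distribution function and its powers *)

Section frechet_cdf_theory.
Variable R : realType.
Implicit Types x a u : R.

Lemma frechet_cdf_bounds x : 0 <= frechet_cdf x <= 1.
Proof.
rewrite /frechet_cdf; case: ifP => [x0|_]; last by rewrite lexx ler01.
by rewrite expR_ge0 -expR0 ler_expR oppr_le0 invr_ge0 ltW.
Qed.

Lemma frechet_cdf_nondecreasing : {homo @frechet_cdf R : x y / x <= y}.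
Proof.
move=> x y xy; rewrite {1}/frechet_cdf; case: ifP => [x0|_]; last first.
  by have /andP[] := frechet_cdf_bounds y.
have y0 := lt_le_trans x0 xy.
by rewrite /frechet_cdf y0 ler_expR lerN2 lef_pV2.
Qed.

Lemma frechet_cdf_powR_nondecreasing a : 0 < a ->
  {homo (fun x => frechet_cdf x `^ a) : x y / x <= y}.
Proof.
move=> a0 x y xy; apply: ge0_ler_powR; first exact: ltW.
- by rewrite nnegrE; have /andP[] := frechet_cdf_bounds x.
- by rewrite nnegrE; have /andP[] := frechet_cdf_bounds y.
- exact: frechet_cdf_nondecreasing.
Qed.

Lemma frechet_cdf_powR_le1 a x : 0 < a -> frechet_cdf x `^ a <= 1.
Proof.
move=> a0; have /andP[F0 F1] := frechet_cdf_bounds x.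
apply: (@le_trans _ _ (1 `^ a)); last by rewrite powR1.
by rewrite ge0_ler_powR ?nnegrE ?ler01 // ltW.
Qed.

(** For x > 0, taking logarithms turns the left side into - a / x <= ln u. For x <= 0 both sides
    hold: the power is 0 and the threshold is positive. *)
Lemma frechet_cdf_powR_le a u x : 0 < a -> 0 < u < 1 ->
  (frechet_cdf x `^ a <= u) = (x <= (- ln u)^-1 * a).
Proof.
move=> a0 u01; have s0 : 0 < - ln u by rewrite oppr_gt0 ln_lt0.
have /andP[u0 _] := u01.
rewrite /frechet_cdf; case: (ltP 0 x) => [x0|x0]; last first.
  rewrite powR0 ?gt_eqF // (ltW u0); apply/esym/(le_trans x0).
  by apply: mulr_ge0; rewrite ?invr_ge0 ltW.
rewrite -[X in _ <= X]lnK // /powR gt_eqF ?expR_gt0 // expRK ler_expR.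
by rewrite mulrN lerNl mulrC !ler_pdivlMl // mulrC.
Qed.

End frechet_cdf_theory.

Lemma archi_mulS (R : archiRealFieldType) (z r : R) : 0 < r ->
  exists n, z <= r * n.+1%:R.
Proof.
move=> r0; exists (Num.bound (`|z| / r)); rewrite -ler_pdivrMl // mulrC.
apply: (@le_trans _ _ (`|z| / r)).
  by rewrite ler_pM2r ?invr_gt0 ?ler_norm.
apply/ltW/(lt_le_trans (archi_boundP _)); first by rewrite divr_ge0 // ltW.
by rewrite ler_nat.
Qed.

(** * The joint distribution function G, its max-stability and tail dependence function *)

Section joint_cdf_theory.
Context (disp : measure_display) (Omega : measurableType disp) (R : realType).
Variables (P : probability Omega R) (d : nat) (X : 'I_d -> {RV P >-> R}).

Lemma measurable_orthant (x : 'I_d -> \bar R) :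
  measurable [set w | forall i, ((X i w)%:E <= x i)%E]%classic.
Proof.
rewrite (_ : [set _ | _]%classic =
  (\bigcap_(i in setT) [set w | ((X i w)%:E <= x i)%E])%classic); last first.
  by apply/seteqP; split=> w /= h i; [move=> _|]; exact: h.
apply: fin_bigcap_measurable => // i _; case: (x i) => [r||].
- rewrite (_ : [set _ | _]%classic = (X i @^-1` `]-oo, r])%classic); last first.
    by apply/seteqP; split=> w /=; rewrite in_itv /= lee_fin.
  exact: measurable_funPTI.
- rewrite (_ : [set _ | _]%classic = setT); first exact: measurableT.
  by apply/seteqP; split=> // w _ /=; rewrite leey.
- rewrite (_ : [set _ | _]%classic = set0); first exact: measurable0.
  by apply/seteqP; split=> // w /=; rewrite leeNy_eq.
Qed.

Lemma joint_cdf_ge0 (x : 'I_d -> \bar R) : 0 <= joint_cdf X x.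
Proof. exact/fine_ge0. Qed.

Lemma le_joint_cdf (x y : 'I_d -> \bar R) : (forall i, x i <= y i)%E ->
  joint_cdf X x <= joint_cdf X y.
Proof.
move=> xy; apply: fine_le; rewrite ?fin_num_measure //;
  try exact: measurable_orthant.
apply: le_measure; rewrite ?inE; try exact: measurable_orthant.
by move=> w /= h i; exact: le_trans (h i) (xy i).
Qed.

(** Continuity of [P] from below along orthants. Each real z <= [y i] has to be reached at a finite
    stage: mere convergence to a finite [y i] could lose the mass on the boundary of the closed
    orthant. *)
Lemma joint_cdf_cvg (x : nat -> 'I_d -> \bar R) (y : 'I_d -> \bar R) :
    (forall m n i, (m <= n)%N -> (x m i <= x n i)%E) ->
    (forall n i, (x n i <= y i)%E) ->
    (forall i (z : R), (z%:E <= y i)%E -> exists n, (z%:E <= x n i)%E) ->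
  (joint_cdf X (x n) @[n --> \oo] --> joint_cdf X y)%classic.
Proof.
move=> xnd xy xz.
pose E n := [set w | forall i, ((X i w)%:E <= x n i)%E]%classic.
have EU : (\bigcup_n E n)%classic =
    [set w | forall i, ((X i w)%:E <= y i)%E]%classic.
  apply/seteqP; split=> [w [n _] h i /=|w /= h].
    exact: le_trans (h i) (xy n i).
  have /choice[f fP] : forall i, exists n, ((X i w)%:E <= x n i)%E.
    by move=> i; exact: xz.
  (* There are finitely many coordinates, so the largest of their stages serves all of them by
     monotonicity. *)
  exists (\max_i f i)%N => // i; apply: le_trans (fP i) _.
  by apply: xnd; exact: leq_bigmax.
have cE : (P \o E @ \oo --> P (\bigcup_n E n))%classic.
  apply: nondecreasing_cvg_mu.
  - by move=> n; exact: measurable_orthant.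
  - by rewrite EU; exact: measurable_orthant.
  - move=> m n mn; apply/subsetPset => w h i.
    exact: le_trans (h i) (xnd _ _ _ mn).
rewrite /joint_cdf -EU; apply: fine_cvg.
by rewrite fineK ?fin_num_measure // EU; exact: measurable_orthant.
Qed.

Lemma joint_cdf_pinfty : joint_cdf X (fun=> +oo%E) = 1.
Proof.
rewrite /joint_cdf (_ : [set _ | _]%classic = setT) ?probability_setT //.
by apply/seteqP; split=> // w _ i; rewrite leey.
Qed.

Hypothesis X_MEV : unit_frechet_MEV X.

(* If G vanishes at x, max-stability makes it vanish along the whole ray
   through x, where it must tend to 1. *)
Lemma joint_cdf_real_gt0 (x : 'I_d -> R) : (forall i, 0 < x i) ->
  0 < joint_cdf X (fun i => (x i)%:E).
Proof.
move=> x0; rewrite lt_neqAle joint_cdf_ge0 andbT eq_sym; apply/eqP => Gx0.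
have c : (joint_cdf X (fun i => (n.+1%:R * x i)%:E) @[n --> \oo] -->
    joint_cdf X (fun=> +oo%E))%classic.
  apply: joint_cdf_cvg => [m n i mn|n i|i z _]; last 2 first.
  - exact: leey.
  - have [n zn] := archi_mulS z (x0 i); exists n.
    by rewrite lee_fin mulrC.
  - by rewrite lee_fin ler_pM2r // ler_nat.
have z n : joint_cdf X (fun i => (n.+1%:R * x i)%:E) = 0.
  have := X_MEV.2 n.+1%:R x (ltr0Sn _ _) x0; rewrite Gx0.
  exact: powR_eq0_eq0.
have c0 : (joint_cdf X (fun i => (n.+1%:R * x i)%:E) @[n --> \oo] -->
    (0 : R))%classic.
  by under eq_fun do rewrite z; exact: cvg_cst.
have c10 : joint_cdf X (fun=> +oo%E) = 0 := norm_cvg_unique c c0.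
by have := oner_neq0 R; rewrite -joint_cdf_pinfty c10 eqxx.
Qed.

(* The max-stability hypothesis only speaks of finite coordinates; infinite
   ones are reached as limits of n.+1, by continuity from below. *)
Let trunc (x : \bar R) (n : nat) : R := if x is r%:E then r else n.+1%:R.

Lemma trunc_gt0 x n : (0 < x)%E -> 0 < trunc x n.
Proof. by case: x. Qed.

Lemma le_trunc x n : (0 < x)%E -> ((trunc x n)%:E <= x)%E.
Proof. by case: x => //= _; exact: leey. Qed.

Lemma joint_cdf_gt0 (x : 'I_d -> \bar R) : (forall i, 0 < x i)%E ->
  0 < joint_cdf X x.
Proof.
move=> x0; have := @joint_cdf_real_gt0 (fun i => trunc (x i) 0).
move=> /(_ (fun i => trunc_gt0 _ (x0 i)))/lt_le_trans; apply.
by apply: le_joint_cdf => i; exact: le_trunc.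
Qed.

(** The factor [t] stays outside the truncation, so that both sides of the finite max-stability
    identity can be passed to the limit, with factors [t] and 1. *)
Lemma joint_cdf_cvg_trunc (x : 'I_d -> \bar R) (t : R) : 0 < t ->
    (forall i, 0 < x i)%E ->
  (joint_cdf X (fun i => (t * trunc (x i) n)%:E) @[n --> \oo] -->
    joint_cdf X (fun i => t%:E * x i)%E)%classic.
Proof.
move=> t0 x0; apply: joint_cdf_cvg => [m n i mn|n i|i z].
- rewrite lee_fin ler_pM2l //.
  by case: (x i) => [r||] /=; rewrite ?lexx ?ler_nat.
- by rewrite EFinM lee_pmul2l // le_trunc.
- case: (x i) (x0 i) => [r _ zr|_ _|//]; first by exists 0%N; rewrite EFinM.
  by have [n zn] := archi_mulS z t0; exists n; rewrite lee_fin.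
Qed.

Lemma joint_cdf_max_stable (t : R) (x : 'I_d -> \bar R) : 0 < t ->
    (forall i, 0 < x i)%E ->
  joint_cdf X (fun i => t%:E * x i)%E `^ t = joint_cdf X x.
Proof.
move=> t0 x0.
have tx0 i : (0 < t%:E * x i)%E by rewrite mule_gt0.
have c1 := joint_cdf_cvg_trunc ltr01 x0.
have c2 := joint_cdf_cvg_trunc t0 x0.
(* Raising to the power [t] is continuous at the limit because G is positive there; uniqueness of
   limits then transfers the identity from the truncations to [x]. *)
have c3 := cvg_comp _ _ c2
  (derivable_cvg1 (@ex_derive _ _ _ _ _ _ _
    (is_derive1_powR t (joint_cdf_gt0 tx0)))).
have <- : joint_cdf X (fun i => 1%:E * x i)%E = joint_cdf X x.
  by congr joint_cdf; apply/funext => i; rewrite mul1e.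
rewrite (_ : (fun n => _) = (fun n =>
  joint_cdf X (fun i => (t * trunc (x i) n)%:E) `^ t)) in c1.
  exact: norm_cvg_unique c3 c1.
apply/funext => n; under eq_fun do rewrite mul1r.
by rewrite (X_MEV.2 t (fun i => trunc (x i) n) t0
  (fun i => trunc_gt0 _ (x0 i))).
Qed.

Lemma inve_EFin_gt0 (a : R) : 0 <= a -> (0 < a%:E^-1)%E.
Proof.
move=> a0; rewrite inver; case: eqVneq => [_|an0]; first exact: ltry.
by rewrite lte_fin invr_gt0 lt_neqAle eq_sym an0.
Qed.

Lemma joint_cdf_tail_dep (a : 'I_d -> R) (u : R) : 0 < u < 1 ->
    (forall i, 0 <= a i) ->
  joint_cdf X (fun i => ((- ln u)^-1)%:E * (a i)%:E^-1)%E = u `^ tail_dep X a.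
Proof.
move=> u01 a0; have s0 : 0 < - ln u by rewrite oppr_gt0 ln_lt0.
have si0 : 0 < (- ln u)^-1 by rewrite invr_gt0.
have x0 i : (0 < (a i)%:E^-1)%E by exact: inve_EFin_gt0.
have G0 := joint_cdf_gt0 x0.
have /andP[u0 _] := u01.
(* With t = (- ln u)^-1, max-stability reads G(t y)^t = G(y), hence G(t y) = G(y)^(- ln u) = u^(- ln
   G(y)). *)
rewrite -[LHS]powRr1 ?joint_cdf_ge0 // -(mulVf (lt0r_neq0 s0)) powRrM.
rewrite joint_cdf_max_stable // /tail_dep /powR !gt_eqF //.
by congr expR; ring.
Qed.

(** G is positive, and it is bounded by the margin of the constrained coordinate [i], which equals
    exp(- a_i) < 1. *)
Lemma tail_dep_gt0 (a : 'I_d -> R) (i : 'I_d) :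
  (forall i, 0 <= a i) -> 0 < a i ->
  0 < tail_dep X a.
Proof.
move=> a0 ai0; rewrite /tail_dep oppr_gt0 ln_lt0 // joint_cdf_gt0 /=;
  last first.
  by move=> k; exact: inve_EFin_gt0.
apply: (@le_lt_trans _ _ (fine (cdf (X i) (a i)^-1))).
  apply: fine_le; rewrite ?fin_num_measure //; try exact: measurable_orthant.
  apply: le_measure; rewrite ?inE; try exact: measurable_orthant.
    exact: measurable_funPTI.
  by move=> w /= /(_ i); rewrite inver gt_eqF // lee_fin in_itv.
rewrite X_MEV.1 /= /frechet_cdf invr_gt0 ai0 invrK.
by rewrite -[ltRHS]expR0 ltr_expR oppr_lt0.
Qed.

End joint_cdf_theory.

(** * Block maxima as finite maxima, and linearity of expectation *)

Lemma bigmax_attained (R : realDomainType) (I : finType) (A : {set I})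
    (f : I -> R) (i : I) :
    i \in A -> 0 <= f i -> (forall k, k \in A -> f k <= f i) ->
  \big[Num.max/0]_(k in A) f k = f i.
Proof.
move=> iA fi0 imax; apply/le_anti/andP; split; first exact: bigmax_le.
exact: le_bigmax_cond.
Qed.

(** A nondecreasing map commutes with a maximum attained at some index of [A]; nonnegativity of [f]
    makes the base value 0 of the big maximum harmless. *)
Lemma block_max_bigmax (disp : measure_display) (Omega : measurableType disp)
    (R : realType) (P : probability Omega R) (d : nat)
    (X : 'I_d -> {RV P >-> R}) (A : {set 'I_d}) (f : R -> R) (w : Omega) :
    A != finset.set0 -> {homo f : x y / x <= y} -> (forall x, 0 <= f x) ->
  f (block_max X A w) = \big[Num.max/0]_(i in A) f (X i w).
Proof.
move=> /set0Pn[k kA] fnd f0.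
case: (@arg_maxP _ _ _ k (mem A) (fun i => X i w) kA) => i iA imax.
rewrite (_ : block_max X A w = X i w).
  by rewrite (bigmax_attained iA) // => l lA; apply: fnd; exact: imax.
by apply: sup_eq_max => [|_ [l lA <-]]; [exists i|exact: imax].
Qed.

Lemma expectation_sum_scaled (disp : measure_display)
    (Omega : measurableType disp) (R : realType) (P : probability Omega R)
    (I : Type) (s : seq I) (Q : pred I) (c m : I -> R) (Y : I -> Omega -> R) :
    (forall i, Y i \in Lfun P 1) ->
    (forall i, Q i -> 'E_P[Y i] = (m i)%:E)%E ->
  (fun w => \sum_(i <- s | Q i) c i * Y i w) \in Lfun P 1 /\
  ('E_P[fun w => (\sum_(i <- s | Q i) c i * Y i w)%R]
   = (\sum_(i <- s | Q i) c i * m i)%:E)%E.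
Proof.
(* Integrability is carried through the induction with the value, since additivity of the
   expectation needs the partial sum to be integrable. *)
move=> LY EY; elim: s => [|i s [IHL IHE]].
  under eq_fun do rewrite big_nil; rewrite big_nil; split.
    exact: rpred0.
  exact: expectation_cst.
rewrite [in X in _ /\ _ = X]big_cons; under eq_fun do rewrite big_cons.
case: ifPn => // Qi.
have Lc : c i \o* Y i \in Lfun P 1.
  rewrite (_ : _ \o* _ = c i *: Y i); first exact: rpredZ.
  by apply/funext => w; rewrite /= mulrC.
rewrite (_ : (fun w => _) =
  (c i \o* Y i) \+ (fun w => \sum_(i <- s | Q i) c i * Y i w)); last first.
  by apply/funext => w; rewrite /= mulrC.
split; first exact: rpredD.
by rewrite expectationD // expectationZl // IHE EY // EFinD EFinM.
Qed.

(** * The max-min coefficient of a partition *)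

Section max_min.
Context (disp : measure_display) (Omega : measurableType disp) (R : realType).
Variables (P : probability Omega R) (d : nat) (X : 'I_d -> {RV P >-> R}).
Hypothesis X_MEV : unit_frechet_MEV X.
Variables (p : nat) (I : 'I_p -> {set 'I_d}) (lambda : 'I_p -> R).
Hypothesis I_partition : is_indexed_partition I.
Hypothesis lambda_gt0 : forall j, 0 < lambda j.

(** By disjointness, the block containing [i] is the only one that can contribute to the sum. *)
Lemma sum_delta_block (c : 'I_p -> R) (T : {set 'I_p}) (i : 'I_d) (j : 'I_p) :
  i \in I j -> \sum_(k in T) c k * delta R i (I k) = if j \in T then c j else 0.
Proof.
case: I_partition => _ Idisj _ ij.
have dk k : k != j -> c k * delta R i (I k) = 0.
  move=> kj; have := finset.in_setI i (I k) (I j).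
  rewrite Idisj // inE ij andbT /delta => <-; exact: mulr0.
case: ifPn => jT.
  rewrite (bigD1 j) //= big1 => [|k /andP[_ kj]]; last exact: dk.
  by rewrite /delta ij mulr1 addr0.
by rewrite big1 // => k kT; apply: dk; apply: contraNneq jT => <-.
Qed.

Lemma block_exists (i : 'I_d) : exists j, i \in I j.
Proof.
case: I_partition => _ _ IU; have : i \in finset.setT by rewrite inE.
by rewrite -IU => /bigcupP[j _ ij]; exists j.
Qed.

(* [block_powF j] is F^(lambda_j)(M(I_j)), as x |-> F(x)^(lambda_j) is
   nondecreasing and nonnegative. *)
Let block_powF (j : 'I_p) (w : Omega) : R :=
  \big[Num.max/0]_(i in I j) frechet_cdf (X i w) `^ lambda j.
Let max_powF (T : {set 'I_p}) (w : Omega) : R :=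
  \big[Num.max/0]_(j in T) block_powF j w.
Let block_weight (T : {set 'I_p}) (i : 'I_d) : R :=
  \sum_(j in T) (lambda j)^-1 * delta R i (I j).

Lemma block_powF_ge0 j w : 0 <= block_powF j w. Proof. exact: bigmax_ge_id. Qed.

Lemma max_powF_bounds T w : 0 <= max_powF T w <= 1.
Proof.
rewrite bigmax_ge_id /=; apply: bigmax_le => // j _; apply: bigmax_le => // i _.
exact: frechet_cdf_powR_le1.
Qed.

Lemma measurable_max_powF T : measurable_fun setT (max_powF T).
Proof.
apply: measurable_bigmaxr => j; apply: measurable_bigmaxr => i.
apply: (@measurableT_comp _ _ _ _ _ _
  (fun x => frechet_cdf x `^ lambda j)); last first.
  exact: measurable_funPT.
apply: nondecreasing_measurable => //.
exact: frechet_cdf_powR_nondecreasing.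
Qed.

HB.instance Definition _ (T : {set 'I_p}) :=
  @isMeasurableFun.Build _ _ _ _ (max_powF T) (measurable_max_powF T).

Lemma block_weight_ge0 T i : 0 <= block_weight T i.
Proof.
by apply: sumr_ge0 => j _; rewrite mulr_ge0 // ?invr_ge0 ?ler0n // ltW.
Qed.

(** Each [i] lies in one block [I j]. If [j] is in [T], the bound is (- ln u)^-1 lambda_j, the
    threshold of [frechet_cdf_powR_le]; otherwise the weight is 0 and its inverse +oo imposes
    nothing. *)
Lemma max_powF_leP T w u : 0 < u < 1 ->
  (max_powF T w <= u) <->
  (forall i, ((X i w)%:E <= ((- ln u)^-1)%:E * (block_weight T i)%:E^-1)%E).
Proof.
move=> u01; have /andP[u0 _] := u01.
have s0 : 0 < (- ln u)^-1 by rewrite invr_gt0 oppr_gt0 ln_lt0.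
split=> [/bigmax_leP[_ YT] i|h].
  have [j ij] := block_exists i.
  rewrite /block_weight (sum_delta_block _ _ ij); case: ifPn => jT; last first.
    by rewrite inver eqxx gt0_muley ?leey.
  rewrite inver invr_eq0 gt_eqF // invrK -EFinM lee_fin -frechet_cdf_powR_le //.
  by have /bigmax_leP[_ ->] := YT j jT.
apply: bigmax_le => [|j jT]; first exact: ltW.
apply: bigmax_le => [|i ij]; first exact: ltW.
rewrite frechet_cdf_powR_le //; have := h i.
rewrite /block_weight (sum_delta_block _ _ ij) jT.
by rewrite inver invr_eq0 gt_eqF // invrK -EFinM lee_fin.
Qed.

Lemma expectation_max_powF (T : {set 'I_p}) : T != finset.set0 ->
  ('E_P[max_powF T] = (e_coef X lambda I T)%:E)%E.
Proof.
move=> /set0Pn[j jT].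
have /set0Pn[i ij] : I j != finset.set0 by case: I_partition.
have l0 : 0 < tail_dep X (block_weight T).
  apply: (tail_dep_gt0 X_MEV (i := i)) => [k|]; first exact: block_weight_ge0.
  by rewrite /block_weight (sum_delta_block _ _ ij) jT invr_gt0.
apply: (expectation_powR_cdf l0) => [w|u u01]; first exact: max_powF_bounds.
rewrite -(joint_cdf_tail_dep X_MEV u01 (block_weight_ge0 T)).
rewrite /joint_cdf fineK; last first.
  by rewrite fin_num_measure //; exact: measurable_orthant.
rewrite /cdf /distribution /pushforward; congr (P _).
apply/seteqP; split=> w /=; rewrite in_itv /=; by move/(max_powF_leP T w u01).
Qed.

Lemma Lfun_max_powF T : max_powF T \in Lfun P 1.
Proof.
apply/Lfun1_integrable/measurable_bounded_integrable => //.
  by rewrite (@le_lt_trans _ _ 1%E) ?probability_le1 ?ltry.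
exists 1; split=> // M M1 w _ /=; have /andP[Y0 Y1] := max_powF_bounds T w.
by rewrite ger0_norm // (le_trans Y1) ?ltW.
Qed.

Lemma max_min_coefE : (0 < d)%N ->
  max_min_coef X lambda I =
  (e_coef X lambda I finset.setT
   - \sum_(T : {set 'I_p} | T != finset.set0)
       (-1) ^+ (#|T| + 1) * e_coef X lambda I T)%:E.
Proof.
(* A coordinate yields a block, so the index set of blocks is nonempty: the extrema over j are
   attained and [finset.setT] is a nonempty [T]. *)
move=> d0; have [j1 _] := block_exists (Ordinal d0).
have VE w j : frechet_cdf (block_max X (I j) w) `^ lambda j = block_powF j w.
  rewrite (block_max_bigmax _ (f := fun x => frechet_cdf x `^ lambda j)) //.
  - by case: I_partition.
  - exact: frechet_cdf_powR_nondecreasing.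
  - by move=> x; exact: powR_ge0.
have [LS ES] := expectation_sum_scaled
  (Q := fun T : {set 'I_p} => T != finset.set0) (index_enum _)
  (fun T => (-1) ^+ (#|T| + 1)) Lfun_max_powF expectation_max_powF.
rewrite EFinD EFinN -ES -expectation_max_powF; last first.
  by apply/set0Pn; exists j1; rewrite inE.
(* Once the expectations are merged, it remains to prove an identity at each outcome: the supremum
   is the maximum over all blocks, and the infimum is the alternating sum. *)
rewrite -expectationB //; last exact: Lfun_max_powF.
rewrite /max_min_coef; congr expectation; apply/funext => w /=.
under eq_fun do rewrite VE.
congr (_ - _).
  case: (@arg_maxP _ _ _ j1 xpredT (fun j => block_powF j w)) => // j0 _ j0_max.
  rewrite /max_powF (bigmax_attained (i := j0)) ?inE ?block_powF_ge0 //;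
    last first.
    by move=> j _; exact: j0_max.
  by apply: sup_eq_max => [|_ [j _ <-]]; [exists j0|exact: j0_max].
case: (@arg_minP _ _ _ j1 xpredT (fun j => block_powF j w)) => // j0 _ j0_min.
rewrite (sum_sign_bigmax (j0 := j0)); last 2 first.
- by move=> j; exact: block_powF_ge0.
- by move=> j; exact: j0_min.
by apply: inf_eq_min => [|_ [j _ <-]]; [exists j0|exact: j0_min].
Qed.

(** With unit exponents the weight of [i] counts the blocks of [T] containing it, which by
    disjointness is the indicator of their union. *)
Lemma e_coef_extremal (T : {set 'I_p}) : e_coef X (fun=> 1) I T =
  extremal_coef X (\bigcup_(j in T) I j)%SET
  / (1 + extremal_coef X (\bigcup_(j in T) I j)%SET).
Proof.
rewrite /e_coef /extremal_coef (_ : (fun i => _) =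
  (fun i => delta R i (\bigcup_(j in T) I j)%SET)) //.
apply/funext => i; have [j ij] := block_exists i.
rewrite (sum_delta_block _ _ ij) invr1 /delta.
case: (boolP (j \in T)) => jT.
  by rewrite (_ : _ \in _) //; apply/bigcupP; exists j.
(* If [i] also lay in a block [I k] with [k] in [T], the same sum would evaluate to 0 through [j]
   and to 1 through [k]. *)
case: (boolP (i \in _)) => // /bigcupP[k kT ik].
have := sum_delta_block (fun=> 1) T ik.
rewrite (sum_delta_block _ _ ij) kT (negbTE jT).
by move=> /esym/eqP; rewrite oner_eq0.
Qed.

End max_min.

Theorem proposition2p2 (disp : measure_display) (Omega : measurableType disp)
    (R : realType) (P : probability Omega R) (d : nat)
    (X : 'I_d -> {RV P >-> R}) (d_gt0 : (0 < d)%N)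
    (X_MEV : unit_frechet_MEV X)
    (p : nat) (I : 'I_p -> {set 'I_d}) (I_partition : is_indexed_partition I) :
  (forall lambda : 'I_p -> R, (forall j, 0 < lambda j) ->
    max_min_coef X lambda I =
    (e_coef X lambda I finset.setT
     - \sum_(T : {set 'I_p} | T != finset.set0)
         (-1) ^+ (#|T| + 1) * e_coef X lambda I T)%:E) /\
  max_min_coef X (fun=> 1) I =
  (extremal_coef X finset.setT / (1 + extremal_coef X finset.setT)
   - \sum_(T : {set 'I_p} | T != finset.set0)
       (-1) ^+ (#|T| + 1)
       * (extremal_coef X (\bigcup_(j in T) I j)%SET
          / (1 + extremal_coef X (\bigcup_(j in T) I j)%SET)))%:E.
Proof.
split=> [lambda lambda_gt0|]; first exact: max_min_coefE.
rewrite max_min_coefE // e_coef_extremal //.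
rewrite (_ : (\bigcup_(j in _) I j)%SET = finset.setT).
  by under eq_bigr => T _ do rewrite e_coef_extremal //.
have [_ _ <-] := I_partition.
by apply: eq_bigl => j; rewrite inE.
Qed.
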